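(* Let $M\ge 1$ and $G\ge 2$ be integers, $K=M+G$, let $c>0$, $\Delta f>0$, $\sigma_w^2>0$, let $\beta_{n1}\in\mathbb{C}\setminus\{0\}$ and $z_{n1}=e^{-j2\pi\Delta f\tau_{n1}}$ with $\tau_{n1}\in\mathbb{R}$. Let the observations be $\bar h_{nk}=\beta_{n1}z_{n1}^k+w_{nk}$, $k=0,\dots,K-1$, where the $w_{nk}$ are i.i.d. zero-mean circularly symmetric complex Gaussian random variables with $\mathbb{E}|w_{nk}|^2=\sigma_w^2$. Then the high-SNR (first-order) variance of the LoS distance estimate $\hat d_{n1}$ produced by the Rank-1 ranging algorithm from these observations is $$V_{\mathrm{R1},n}=\left(\frac{c}{2\pi\Delta f}\right)^2\frac{\min(M+1,\,G-1)}{(M+1)^2(G-1)^2}\,\frac{\sigma_w^2}{|\beta_{n1}|^2}.$$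
   Context: Rank-1 ranging algorithm. Given $h=(h_0,\dots,h_{K-1})\in\mathbb{C}^K$, form the $(M+1)\times G$ Hankel matrix $\mathbf H_n(h)$ with entries $[\mathbf H_n]_{p,q}=h_{p+q}$, $0\le p\le M$, $0\le q\le G-1$. Let $\widetilde{\mathbf H}_n=\sigma_{R,1}\mathbf u_{R,1}\mathbf v_{R,1}^H$ be its rank-one truncated singular value decomposition, where $\sigma_{R,1}$ is the largest singular value and $\mathbf u_{R,1},\mathbf v_{R,1}$ are the associated unit left and right singular vectors. Let $\widetilde{\mathbf H}_{n,A}$ and $\widetilde{\mathbf H}_{n,B}$ be the $(M+1)\times(G-1)$ submatrices of $\widetilde{\mathbf H}_n$ consisting of its first $G-1$ columns and its last $G-1$ columns, respectively. The pole estimate is the least-squares solution $$\hat z_{n1}(h)=\frac{\mathrm{Tr}(\widetilde{\mathbf H}_{n,A}^H\widetilde{\mathbf H}_{n,B})}{\mathrm{Tr}(\widetilde{\mathbf H}_{n,A}^H\widetilde{\mathbf H}_{n,A})}.$$ This is well defined for $h$ near $h^{o}$, where $h^o_k=\beta_{n1}z_{n1}^k$; there the largest singular value is simple and $\hat z_{n1}(h^o)=z_{n1}$. The delay and distance estimates are $$\hat\tau_{n1}=-\frac{\arg\hat z_{n1}}{2\pi\Delta f},\qquad \hat d_{n1}=c\,\hat\tau_{n1}=-\frac{c}{2\pi\Delta f}\arg\hat z_{n1},$$ with $\arg$ a branch continuous near $z_{n1}$. High-SNR (first-order) variance. With $w=(w_{n0},\dots,w_{n(K-1)})$, the first-order distance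 error is the random variable $$\frac{d}{dt}\Big|_{t=0}\hat d_{n1}(h^{o}+t\,w),$$ where the derivative is in real $t$. The high-SNR (first-order) variance of $\hat d_{n1}$ is the variance of this random variable. *)

(* Defs.v *)
From HB Require Import structures.
From mathcomp Require Import all_boot all_order all_algebra.
From mathcomp Require Import complex.
From mathcomp Require Import all_classical all_reals all_analysis.

Set Implicit Arguments.
Unset Strict Implicit.
Unset Printing Implicit Defensive.

Import Order.TTheory GRing.Theory Num.Theory.
Import numFieldNormedType.Exports.

Local Open Scope classical_set_scope.
Local Open Scope ring_scope.
Local Open Scope complex_scope.
Local Open Scope sesquilinear_scope.

Section ComplexNumbers.
Context {R : realType}.
Implicit Types (theta : R) (z : R[i]).

Definition expi theta : R[i] := cos theta +i* sin theta.

Definition cmod z : R := ComplexField.Normc.normc z.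

(* [arg] is a continuous determination of the argument near [z0]; [R[i]^o]
   carries the usual topology of the complex plane. *)
Definition arg_branch (z0 : R[i]) (arg : R[i] -> R) : Prop :=
  \forall z \near (z0 : R[i]^o),
    z = (cmod z)%:C * expi (arg z) /\ {for z, continuous (arg : R[i]^o -> R)}.

End ComplexNumbers.

Section TruncatedSVD.
Context {R : realType} {m n : nat}.
Implicit Types (A B : 'M[R[i]]_(m, n)) (s : R).
Implicit Types (u : 'cV[R[i]]_m) (v : 'cV[R[i]]_n).

Definition singular_triple A s u v : Prop :=
  [/\ 0 <= s, u ^t* *m u = 1%:M, v ^t* *m v = 1%:M,
      A *m v = s%:C *: u & A ^t* *m u = s%:C *: v].

Definition top_singular_triple A s u v : Prop :=
  singular_triple A s u v /\
  forall s' u' v', singular_triple A s' u' v' -> s' <= s.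

Definition is_rank1_svd A B : Prop :=
  exists s u v, top_singular_triple A s u v /\ B = s%:C *: (u *m v ^t*).

(* Some choice is made when the largest singular value is not simple. *)
Definition rank1_svd A : 'M[R[i]]_(m, n) := xget 0 [set B | is_rank1_svd A B].

End TruncatedSVD.

Lemma hankel_subproof (M G : nat) (p : 'I_M.+1) (q : 'I_G) : (p + q < M + G)%N.
Proof. by rewrite -addnS leq_add // -ltnS. Qed.

Lemma last_cols_subproof (G : nat) (q : 'I_G.-1) : (q.+1 < G)%N.
Proof. by rewrite -ltn_predRL. Qed.

Section Rank1Ranging.
Context {R : realType} {M G : nat}.
Implicit Types (h : 'rV[R[i]]_(M + G)).

Definition hankel h : 'M[R[i]]_(M.+1, G) :=
  \matrix_(p < M.+1, q < G) h 0 (Ordinal (hankel_subproof p q)).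

Definition first_cols (A : 'M[R[i]]_(M.+1, G)) : 'M[R[i]]_(M.+1, G.-1) :=
  colsub (widen_ord (leq_pred G)) A.

Definition last_cols (A : 'M[R[i]]_(M.+1, G)) : 'M[R[i]]_(M.+1, G.-1) :=
  colsub (fun q : 'I_G.-1 => Ordinal (last_cols_subproof q)) A.

Definition pole_estimate h : R[i] :=
  let H := rank1_svd (hankel h) in
  \tr ((first_cols H) ^t* *m last_cols H) /
  \tr ((first_cols H) ^t* *m first_cols H).

Definition delay_estimate (df : R) (arg : R[i] -> R) h : R :=
  - arg (pole_estimate h) / (2 * pi * df).

Definition distance_estimate (c df : R) (arg : R[i] -> R) h : R :=
  c * delay_estimate df arg h.

Definition pure_channel (beta z : R[i]) : 'rV[R[i]]_(M + G) :=
  \row_k (beta * z ^+ k).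

(* The noise is scaled by a real [t]; [t = 1] gives the actual observations. *)
Definition observations (beta z : R[i]) (w : 'I_(M + G) -> R[i]) (t : R) :
    'rV[R[i]]_(M + G) :=
  pure_channel beta z + t%:C *: \row_k w k.

End Rank1Ranging.

Section ComplexRandomVariables.
Context {R : realType} {d : measure_display} {T : measurableType d}.
Variable P : probability T R.
Implicit Types (X : T -> R[i]).

(* Borel sets and measurability in the complex plane, identified with R * R. *)
Definition borelC (A : set R[i]) : Prop :=
  measurable [set p : R * R | A (p.1 +i* p.2)].

Definition complex_rv X : Prop :=
  measurable_fun setT (fun omega => complex.Re (X omega)) /\
  measurable_fun setT (fun omega => complex.Im (X omega)).

Definition mutually_independent n (w : 'I_n -> T -> R[i]) : Prop :=
  forall (J : {set 'I_n}) (A : 'I_n -> set R[i]),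
    (forall k, borelC (A k)) ->
    P (\bigcap_(k in [set` J]) (w k @^-1` A k)) =
    (\prod_(k in J) P (w k @^-1` A k))%E.

Definition identically_distributed n (w : 'I_n -> T -> R[i]) : Prop :=
  forall (k l : 'I_n) (A : set R[i]),
    borelC A -> P (w k @^-1` A) = P (w l @^-1` A).

(* The second case is needed because [normal_prob m 0] is, by convention, not
   the point mass at [m]. *)
Definition gaussian_rv (X : T -> R) : Prop :=
  (exists m s : R, 0 < s /\
     forall B : set R, measurable B -> P (X @^-1` B) = normal_prob m s B) \/
  (exists m : R,
     forall B : set R, measurable B -> P (X @^-1` B) = \d_m B).

(* Real and imaginary parts are jointly Gaussian. *)
Definition complex_gaussian X : Prop :=
  forall a b : R,
    gaussian_rv (fun omega => a * complex.Re (X omega) + b * complex.Im (X omega)).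

Definition circularly_symmetric X : Prop :=
  forall (theta : R) (A : set R[i]), borelC A ->
    P ((fun omega => expi theta * X omega) @^-1` A) = P (X @^-1` A).

Definition zero_mean X : Prop :=
  'E_P[fun omega => complex.Re (X omega)]%E = 0%E /\
  'E_P[fun omega => complex.Im (X omega)]%E = 0%E.

Definition mean_power X : \bar R := ('E_P[(fun omega => cmod (X omega) ^+ 2)%R])%E.

End ComplexRandomVariables.

Section FirstOrderError.
Context {R : realType} {M G : nat} {d : measure_display} {T : measurableType d}.

Definition noisy_distance (c df : R) (arg : R[i] -> R) (beta z : R[i])
    (w : 'I_(M + G) -> R[i]) (t : R) : R :=
  distance_estimate c df arg (observations beta z w t).

Definition first_order_error (c df : R) (arg : R[i] -> R) (beta z : R[i])
    (w : 'I_(M + G) -> T -> R[i]) (omega : T) : R :=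
  derive1 (noisy_distance c df arg beta z (fun k => w k omega)) 0.

End FirstOrderError.

(* Main.v *)
(* If [(s, u, v)] is a top singular triple of the Hankel matrix [H(t)], the pole
   estimate depends only on the right vector: it is the least squares quotient
   of [x_q = sum_p y_p H(t)_(p,q)] for any [y] proportional to the conjugate of
   [u].  Since [s u = H(t) v] and [H(0)] has rank one with column space spanned
   by [(z^p)_p], [y_p] can be normalized to [conj(z)^p + O(t)]; no
   differentiability of the singular vectors is needed.  Writing
   [x_q = z^q (B(t) + t m_q(t))], the imaginary part of the numerator of the
   rotated quotient is, up to [O(t^2)], [t Im(conj B (m_(q+1) - m_q))] summed
   over [q], which telescopes.  With [n_k = conj(z)^k w_k], the derivative of
   the argument is therefore [Im(conj beta * sum_p (n_(p+G-1) - n_p))] divided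
   by [|beta|^2 (M+1) (G-1)].  The index ranges [0..M] and [G-1..M+G-1] have a
   symmetric difference of size [2 min(M+1, G-1)], and the surviving terms are
   uncorrelated with variance [|beta|^2 sigma^2 / 2] by circular symmetry. *)

Require Import Defs.
From HB Require Import structures.
From mathcomp Require Import all_boot all_order all_algebra.
From mathcomp Require Import complex.
From mathcomp Require Import all_classical all_reals all_analysis.
From mathcomp Require Import measurable_realfun.
From mathcomp Require Import ring lra.

Set Implicit Arguments.
Unset Strict Implicit.
Unset Printing Implicit Defensive.

Import Order.TTheory GRing.Theory Num.Theory.
Import numFieldNormedType.Exports.

Local Open Scope classical_set_scope.
Local Open Scope ring_scope.

Local Notation "x %:C" := (real_complex _ x) : ring_scope.

(** * Rank-one truncation *)

Lemma conjC_real (R : realType) (x : R) : (x%:C)^* = x%:C.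
Proof. by apply/CrealP/complex_realP; exists x. Qed.

Section GramMatrix.
Local Open Scope sesquilinear_scope.
Context {R : realType} {m n : nat}.
Implicit Types (A : 'M[R[i]]_(m, n)).

Lemma adjmxZ (a : R[i]) A : (a *: A) ^t* = a^* *: A ^t*.
Proof. by apply/matrixP => i j; rewrite !mxE rmorphM. Qed.

Lemma gram_hermsym A : A ^t* *m A \is hermsymmx.
Proof.
apply/is_hermitianmxP; rewrite expr0 scale1r trmx_mul map_mxM.
by rewrite trmxCK.
Qed.

(** The squared Frobenius norm; in this form the trace dominates the square of every single
    entry. *)
Lemma tr_gramE A : \tr (A ^t* *m A) = \sum_i \sum_j `|A i j| ^+ 2.
Proof.
rewrite /mxtrace exchange_big /=; apply: eq_bigr => j _.
by rewrite mxE; apply: eq_bigr => i _; rewrite !mxE mulrC -normCK.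
Qed.

Lemma tr_gram_ge0 A : 0 <= \tr (A ^t* *m A).
Proof.
by rewrite tr_gramE; do 2!apply: sumr_ge0 => ? _; rewrite exprn_ge0.
Qed.

Lemma tr_gram_gt0 A : A != 0 -> 0 < \tr (A ^t* *m A).
Proof.
move=> A0; rewrite lt_def tr_gram_ge0 andbT; apply: contraNneq A0 => /eqP.
rewrite tr_gramE psumr_eq0; last first.
  by move=> i _; apply: sumr_ge0 => ? _; rewrite exprn_ge0.
move=> /allP h; apply/eqP/matrixP => i j; rewrite mxE.
have := h i (mem_index_enum _); rewrite /= psumr_eq0; last first.
  by move=> k _; rewrite exprn_ge0.
move=> /allP /(_ j (mem_index_enum _)).
by rewrite /= expf_eq0 /= normr_eq0 => /eqP.
Qed.

End GramMatrix.

Section SingularTriples.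
Local Open Scope sesquilinear_scope.
Context {R : realType} {m n : nat}.
Implicit Types (A : 'M[R[i]]_(m, n)).

(** The spectral theorem for the Gram matrix [B] gives a unit eigenvector [v] for its largest
    eigenvalue [s ^+ 2], and [u] is [A v / s]. The trace is a sum of [n] eigenvalues, none above
    [s ^+ 2]; this bound later keeps [s] away from zero. *)
Lemma top_singular_triple_ex A : A != 0 ->
  exists s u v, top_singular_triple A s u v /\
    \tr (A ^t* *m A) <= (s ^+ 2 *+ n)%:C.
Proof.
move=> A0; pose B := A ^t* *m A.
have hB : B \is hermsymmx by exact: gram_hermsym.
pose U := spectralmx B; pose l := spectral_diag B.
have uU : U \is unitarymx by exact: spectral_unitarymx.
have eqB : B = U ^t* *m diag_mx l *m U.
  rewrite -(invmx_unitary uU).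
  by have /hermitian_normalmx /orthomx_spectralP := hB.
have UU : U *m U ^t* = 1%:M by apply/unitarymxP.
have trB : \tr B = \sum_i l 0 i.
  by rewrite eqB mxtrace_mulC mulmxA UU mul1mx mxtrace_diag.
pose V i := col i (U ^t*).
have diagE i : diag_mx l *m delta_mx i 0 = l 0 i *: delta_mx i (0 : 'I_1).
  apply/matrixP => j k; rewrite mul_diag_mx !mxE.
  by case: eqP => [->|] //=; rewrite !mulr0.
have VE i : V i = U ^t* *m delta_mx i 0 by rewrite /V colE.
have BV i : B *m V i = l 0 i *: V i.
  rewrite VE eqB -!mulmxA (mulmxA U) UU mul1mx diagE.
  by rewrite -scalemxAr.
have VV i : (V i) ^t* *m V i = 1%:M.
  rewrite VE trmx_mul map_mxM trmxCK -!mulmxA (mulmxA U) UU mul1mx.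
  rewrite trmx_delta map_delta_mx mul_delta_mx.
  by apply/matrixP => a b; rewrite !mxE !ord1.
have AV i : (A *m V i) ^t* *m (A *m V i) = (l 0 i)%:M.
  rewrite trmx_mul map_mxM -!mulmxA (mulmxA (A ^t*)) BV.
  by rewrite -scalemxAr VV scalemx1.
have l_ge0 i : 0 <= l 0 i.
  by have := tr_gram_ge0 (A *m V i); rewrite AV mxtrace_scalar.
have lE i : l 0 i = (complex.Re (l 0 i))%:C by rewrite RRe_real // ger0_real.
have Rl_ge0 i : 0 <= complex.Re (l 0 i) by have := l_ge0 i; rewrite {1}lE ler0c.
have trB0 : 0 < \tr B by exact: tr_gram_gt0.
(* A positive trace excludes [n = 0], so the search for the largest eigenvalue has a starting
   index. *)
have [i0] : exists i0 : 'I_n, true.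
  case: (pickP (fun _ : 'I_n => true)) => [i0 _|h]; first by exists i0.
  by move: trB0; rewrite trB big_pred0 // ltxx.
move=> _; case: (arg_maxP (fun i => complex.Re (l 0 i)) (isT : predT i0)).
move=> i _ imax.
set r := complex.Re (l 0 i); pose s := Num.sqrt r.
have s2 : s ^+ 2 = r by rewrite sqr_sqrtr //; exact: Rl_ge0.
have le_tr : \tr B <= (s ^+ 2 *+ n)%:C.
  rewrite trB (_ : (s ^+ 2 *+ n)%:C = \sum_(j < n) r%:C).
    by apply: ler_sum => j _; rewrite lE lecR; exact: imax.
  by rewrite sumr_const card_ord s2 rmorphMn.
have s_gt0 : 0 < s.
  rewrite lt_def sqrtr_ge0 andbT; apply: contraTneq trB0 => s0.
  by rewrite le_gtF // (le_trans le_tr) // s0 expr0n /= mul0rn.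
exists s, (s^-1%:C *: (A *m V i)), (V i); split => //; split.
  split => //.
  - exact: ltW.
  - rewrite adjmxZ -scalemxAr -scalemxAl AV scalerA.
    rewrite lE -/r -s2 scale_scalar_mx conjC_real -!rmorphM.
    by congr (_%:M); rewrite -[RHS]/(1%:C); congr _%:C; field; rewrite gt_eqF.
  - by rewrite scalerA -rmorphM divff ?gt_eqF // scale1r.
  - rewrite -scalemxAr mulmxA BV scalerA lE -/r -s2 -rmorphM.
    by congr (_%:C *: _); field; rewrite gt_eqF.
(* Maximality: the square of any singular value is an eigenvalue of [B], and a nonzero coordinate of
   [v'] in the spectral basis identifies it with some [l 0 j]. *)
move=> s' u' v' [s'0 uu vv Av Au].
have Bv : B *m v' = (s' ^+ 2)%:C *: v'.
  by rewrite /B -mulmxA Av -scalemxAr Au scalerA -rmorphM -expr2.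
pose y := U *m v'.
have Dy : diag_mx l *m y = (s' ^+ 2)%:C *: y.
  by rewrite /y scalemxAr -Bv eqB !mulmxA UU mul1mx.
have [j yj] : exists j, y j 0 != 0.
  apply/existsP; apply: contraT; rewrite negb_exists => /forallP y0.
  have y00 : y = 0.
    by apply/matrixP => a b; rewrite ord1 [RHS]mxE; exact/eqP/negbNE/y0.
  have v0 : v' = 0.
    have := unitarymx_unit uU => Uu; rewrite -[v'](mulKmx Uu) -/y y00.
    by rewrite mulmx0.
  by move/matrixP: vv => /(_ 0 0)/eqP; rewrite v0 mulmx0 !mxE eq_sym oner_eq0.
have /eqP : l 0 j * y j 0 = (s' ^+ 2)%:C * y j 0.
  by have := congr1 (fun X : 'cV_n => X j 0) Dy; rewrite mul_diag_mx !mxE.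
rewrite (inj_eq (mulIf yj)) => /eqP lj.
rewrite -(@ler_pXn2r _ 2) ?nnegrE ?sqrtr_ge0 // s2.
by rewrite (le_trans _ (imax j isT)) // lj.
Qed.

(** The choice in [rank1_svd] may return the truncation of a top triple other than the constructed
    one. Maximality of both makes their singular values equal, so the trace bound carries over. *)
Lemma rank1_svdP A : A != 0 ->
  exists s u v, [/\ singular_triple A s u v,
    \tr (A ^t* *m A) <= (s ^+ 2 *+ n)%:C & rank1_svd A = s%:C *: (u *m v ^t*)].
Proof.
move=> A0; have [s [u [v [top trA]]]] := top_singular_triple_ex A0.
have [s' [u' [v' [top' E]]]] : is_rank1_svd A (rank1_svd A).
  by apply: (@xgetPex _ _ [set B | is_rank1_svd A B]); exists (s%:C *: (u *m v ^t*)), s, u, v.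
exists s', u', v'; split => //; first exact: top'.1.
suff -> : s' = s by [].
by apply/eqP; rewrite eq_le (top.2 _ _ _ top'.1) (top'.2 _ _ _ top.1).
Qed.
End SingularTriples.

(** * The pole estimate along a noise direction *)

Section ComplexModulus.
Context {R : realType}.
Implicit Types (x y : R[i]).

Lemma normC_cmod x : `|x| = (cmod x)%:C.
Proof. by rewrite normc_def; case: x. Qed.

Lemma cmod_ge0 x : 0 <= cmod x.
Proof. by rewrite -ler0c -normC_cmod. Qed.

Lemma cmodD x y : cmod (x + y) <= cmod x + cmod y.
Proof. by rewrite -lecR rmorphD -!normC_cmod ler_normD. Qed.

Lemma cmodM x y : cmod (x * y) = cmod x * cmod y.
Proof. exact: ComplexField.Normc.normcM. Qed.

Lemma cmodV x : cmod x^-1 = (cmod x)^-1.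
Proof. exact: ComplexField.Normc.normcV. Qed.

Lemma cmod0 : cmod (0 : R[i]) = 0.
Proof. exact: ComplexField.Normc.normc0. Qed.

Lemma cmod_eq0 x : (cmod x == 0) = (x == 0).
Proof.
apply/eqP/eqP => [|->]; last exact: cmod0.
exact: ComplexField.Normc.eq0_normc.
Qed.

Lemma cmod_gt0 x : (0 < cmod x) = (x != 0).
Proof. by rewrite lt_def cmod_ge0 andbT cmod_eq0. Qed.

Lemma cmodX x n : cmod (x ^+ n) = cmod x ^+ n.
Proof.
elim: n => [|n IH]; first exact: ComplexField.Normc.normc1.
by rewrite !exprS cmodM IH.
Qed.

Lemma cmod_conj x : cmod x^* = cmod x.
Proof.
by apply: (@complexI R); rewrite -!normC_cmod norm_conjC.
Qed.

Lemma cmod_real (a : R) : cmod a%:C = `|a|.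
Proof. by rewrite /cmod /= expr0n /= addr0 sqrtr_sqr. Qed.

Lemma cmod_sum (I : Type) (r : seq I) (Q : pred I) (F : I -> R[i]) :
  cmod (\sum_(i <- r | Q i) F i) <= \sum_(i <- r | Q i) cmod (F i).
Proof.
elim/big_ind2: _ => // [|a b c d ab cd]; first by rewrite cmod0.
by rewrite (le_trans (cmodD _ _)) // lerD.
Qed.

Lemma cmod_sqr x : (cmod x ^+ 2)%:C = x^* * x.
Proof. by rewrite rmorphXn /= -normC_cmod normCK mulrC. Qed.

End ComplexModulus.

(** * The least squares quotient of a rank-one matrix *)

Section PoleOfRankOne.
Local Open Scope sesquilinear_scope.
Context {R : realType} {M G : nat}.

(* For a matrix [r x^T] of rank one, the left factor cancels in the least
   squares quotient. *)
Lemma pole_estimate_outer (h : 'rV[R[i]]_(M + G)) (r : 'I_M.+1 -> R[i])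
    (x : nat -> R[i]) :
  (forall p (q : 'I_G), rank1_svd (hankel h) p q = r p * x q) ->
  (exists p, r p != 0) ->
  pole_estimate h = (\sum_(q < G.-1) (x q)^* * x q.+1) /
                    (\sum_(q < G.-1) (x q)^* * x q).
Proof.
move=> rx [p0 rp0]; rewrite /pole_estimate.
set H := rank1_svd _ in rx *; pose S := \sum_p (r p)^* * r p.
have S0 : S != 0.
  rewrite psumr_neq0 => [|p _]; last by rewrite mulrC -normCK exprn_ge0.
  by apply/hasP; exists p0 => //; rewrite mulrC -normCK exprn_gt0 // normr_gt0.
(* Numerator and denominator are treated at once: [f] is the shift or the identity, and both traces
   carry the factor [S]. *)
have trE (f : 'I_G.-1 -> nat) (B : 'M[R[i]]_(M.+1, G.-1)) :
    (forall p q, B p q = r p * x (f q)) ->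
    \tr ((first_cols H) ^t* *m B) = S * \sum_(q < G.-1) (x q)^* * x (f q).
  move=> BE; rewrite /mxtrace mulr_sumr; apply: eq_bigr => q _.
  rewrite mxE mulr_suml; apply: eq_bigr => p _.
  by rewrite !mxE BE rx rmorphM /=; ring.
rewrite (trE (fun q => q.+1)) => [|p q]; last by rewrite mxE rx.
rewrite (trE (fun q => q)) => [|p q]; last by rewrite mxE rx.
by rewrite -mulf_div divff // mul1r.
Qed.

End PoleOfRankOne.

Lemma near0_normM_le (R : realType) (c e : R) : 0 <= c -> 0 < e ->
  \forall t \near (0 : R), `|t| * c <= e.
Proof.
move=> c0 e0; have c1 : 0 < c + 1 by rewrite ltr_wpDl.
near=> t.
have te : `|t| <= e / (c + 1).
  near: t; exists (e / (c + 1)) => [|y] /=; first by rewrite divr_gt0.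
  by rewrite sub0r normrN => /ltW.
apply: (@le_trans _ _ (e / (c + 1) * (c + 1))); last by rewrite divfK ?gt_eqF.
by rewrite ler_pM // lerDl.
Unshelve. all: by end_near.
Qed.

(** * Perturbation of the top left singular vector *)

Section PerturbedPole.
Local Open Scope sesquilinear_scope.
Context {R : realType} {M G : nat}.

(** This trades the truncated decomposition for explicit weights, uniformly within [O(t)] of their
    noiseless values. The weights are obtained for each [t] separately, without any regularity in
    [t]. The extension [wn] of the noise to all naturals spares bound proofs on indices such as
    [p + q]. *)
Lemma pole_estimate_near (beta z : R[i]) (w : 'I_(M + G) -> R[i])
    (wn : nat -> R[i]) : (0 < G)%N -> (forall k, w k = wn k) ->
  beta != 0 -> cmod z = 1 ->
  exists C : R, \forall t \near (0 : R), exists eta : 'I_M.+1 -> R[i],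
    (forall p, cmod (eta p) <= C * `|t|) /\
    let x q := \sum_(p < M.+1)
      (z^* ^+ p + eta p) * (beta * z ^+ (p + q) + t%:C * wn (p + q)%N) in
    pole_estimate (observations beta z w t) =
      (\sum_(q < G.-1) (x q)^* * x q.+1) / (\sum_(q < G.-1) (x q)^* * x q).
Proof.
move=> G0 wE b0 z1.
pose W : R := \sum_(p < M.+1) \sum_(q < G) cmod (wn (p + q)%N).
have W0 : 0 <= W by do 2!(apply: sumr_ge0 => ? _); exact: cmod_ge0.
pose N : R := M.+1%:R * G%:R.
have N1 : 1 <= N by rewrite /N -natrM ler1n muln_gt0.
(* Chosen so that [N * kap ^+ 2], which is [|beta|^2 / (16 N)], falls below the bound [|beta|^2 / 4]
   of [s2G]. *)
pose kap := cmod beta / (4 * N).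
have bpos : 0 < cmod beta by rewrite cmod_gt0.
have kap0 : 0 < kap by rewrite divr_gt0 // mulr_gt0 // (lt_le_trans ltr01).
(* The bound [|t| W] on the noise term [e], divided by the lower bound [kap / 2] on [|k|]. *)
exists (2 * W / kap).
have tW : \forall t \near (0 : R), `|t| * W <= kap / 2 /\ `|t| * cmod (wn 0%N) <= cmod beta / 2.
  by apply: filterI; apply: near0_normM_le => //; [exact: divr_gt0|exact: cmod_ge0|exact: divr_gt0].
near=> t.
have [t1 t2] : `|t| * W <= kap / 2 /\ `|t| * cmod (wn 0%N) <= cmod beta / 2 by near: t.
set h := observations _ _ _ _; pose A := hankel h.
have AE p q : A p q = beta * z ^+ (p + q) + t%:C * wn (p + q)%N.
  by rewrite !mxE wE.
pose q0 : 'I_G := Ordinal G0.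
(* The corner entry [beta + t w_0] alone shows that the matrix is nonzero and bounds its Frobenius
   norm from below. *)
have A00 : cmod beta / 2 <= cmod (A ord0 q0).
  rewrite AE /= addn0 mulr1.
  have := cmodD (beta + t%:C * wn 0%N) (- (t%:C * wn 0%N)).
  rewrite addrK -mulNr -rmorphN cmodM cmod_real normrN => h1.
  lra.
have A0 : A != 0.
  apply: contraTneq A00 => ->; rewrite mxE cmod0 -ltNge; lra.
have [s [u [v [[s0 uu vv Av Au] trA svdA]]]] := rank1_svdP A0.
have v2 : \sum_q cmod (v q 0) ^+ 2 = 1.
  apply: (@complexI R); rewrite rmorph_sum rmorph1 /=.
  move/matrixP: vv => /(_ 0 0); rewrite !mxE /= => vv; apply: etrans vv.
  by apply: eq_bigr => q _; rewrite !mxE cmod_sqr.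
have u2 : \sum_p cmod (u p 0) ^+ 2 = 1.
  apply: (@complexI R); rewrite rmorph_sum rmorph1 /=.
  move/matrixP: uu => /(_ 0 0); rewrite !mxE /= => uu; apply: etrans uu.
  by apply: eq_bigr => q _; rewrite !mxE cmod_sqr.
have v1 q : cmod (v q 0) <= 1.
  rewrite -(@expr_le1 _ 2) ?cmod_ge0 // -v2 (bigD1 q) //= lerDl.
  by apply: sumr_ge0 => ? _; rewrite exprn_ge0 ?cmod_ge0.
have s2G : cmod beta ^+ 2 / 4 <= s ^+ 2 * G%:R.
  apply: (@le_trans _ _ (cmod (A ord0 q0) ^+ 2)).
    have : (cmod beta / 2) ^+ 2 <= cmod (A ord0 q0) ^+ 2.
      by rewrite ler_pXn2r // nnegrE ?cmod_ge0 // divr_ge0 // cmod_ge0.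
    by rewrite expr_div_n; lra.
  rewrite mulr_natr -lecR (le_trans _ trA) // tr_gramE.
  rewrite (bigD1 ord0) //= (bigD1 q0) //= normC_cmod -rmorphXn -addrA lerDl.
  rewrite addr_ge0 //; first by apply: sumr_ge0 => ? _; rewrite exprn_ge0.
  by do 2!(apply: sumr_ge0 => ? _); rewrite exprn_ge0.
have s_gt0 : 0 < s.
  rewrite lt_def s0 andbT; apply: contraTneq s2G => ->.
  by rewrite expr0n mul0r -ltNge divr_gt0 // exprn_gt0.
pose k : R[i] := beta * \sum_(q < G) z ^+ q * v q 0.
pose e (p : 'I_M.+1) : R[i] := t%:C * \sum_(q < G) wn (p + q)%N * v q 0.
(* The relation [s u = A v] splits into signal and noise; the noiseless Hankel matrix has rank one,
   so the signal part is a multiple [k] of the powers of [z]. *)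
have su p : s%:C * u p 0 = k * z ^+ p + e p.
  move/matrixP: Av => /(_ p 0); rewrite [RHS]mxE => <-.
  rewrite mxE /k /e !(mulr_sumr, mulr_suml) -big_split /=.
  by apply: eq_bigr => q _; rewrite AE exprD; ring.
have e_le p : cmod (e p) <= `|t| * W.
  rewrite cmodM cmod_real ler_wpM2l // (le_trans (cmod_sum _ _ _)) //.
  rewrite /W (bigD1 p) //= -[leLHS]addr0 lerD //; last first.
    by do 2!(apply: sumr_ge0 => ? _); exact: cmod_ge0.
  apply: ler_sum => q _; rewrite cmodM ler_piMr ?cmod_ge0 //.
(* The top singular value stays away from [0] by the trace bound, so [u] cannot
   be nearly orthogonal to the signal direction. *)
have k_ge : kap / 2 <= cmod k.
  rewrite leNgt; apply/negP => k_lt.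
  have su_le p : s * cmod (u p 0) <= kap.
    have -> : s * cmod (u p 0) = cmod (s%:C * u p 0).
      by rewrite cmodM cmod_real ger0_norm.
    rewrite su (le_trans (cmodD _ _)) // cmodM cmodX z1 expr1n mulr1.
    by have := e_le p; lra.
  (* Every entry of [s u] is at most [kap] in modulus and [u] has norm one. With [s2G] this would
     give [|beta|^2 / 4 <= |beta|^2 / (16 N)], impossible for [N >= 1]. *)
  have : s ^+ 2 <= M.+1%:R * kap ^+ 2.
    have : s ^+ 2 * (\sum_p cmod (u p 0) ^+ 2) <= \sum_(p < M.+1) kap ^+ 2; last first.
      by rewrite u2 mulr1 sumr_const card_ord mulr_natl.
    rewrite mulr_sumr; apply: ler_sum => p _.
    by rewrite -exprMn ler_pXn2r ?nnegrE ?su_le ?(ltW kap0) // mulr_ge0 ?cmod_ge0.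
  move=> s2M; have : cmod beta ^+ 2 / 4 <= N * kap ^+ 2.
    by rewrite (le_trans s2G) // /N [leRHS]mulrAC ler_wpM2r // ler0n.
  have -> : N * kap ^+ 2 = cmod beta ^+ 2 / (16 * N).
    by rewrite /kap; field; lra.
  apply/negP; rewrite -ltNge ltr_pM2l ?exprn_gt0 // ltf_pV2 ?posrE; lra.
have k0 : k != 0 by rewrite -cmod_gt0; lra.
clearbody k e.
(* Dividing the conjugate of [s u = k (z^p)_p + e] by [conj k] gives [conj(z)^p + O(t)]. *)
exists (fun p => (e p)^* / k^*); split=> [p|].
  rewrite cmodM cmodV !cmod_conj ler_pdivrMr ?cmod_gt0 //.
  rewrite (le_trans (e_le p)) //.
  rewrite -[leLHS]mulr1 (_ : 2 * W / kap * `|t| * cmod k = (`|t| * W) * (cmod k / (kap / 2))).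
    by rewrite ler_wpM2l ?mulr_ge0 // ler_pdivlMr ?mul1r // divr_gt0.
  by field; lra.
pose x (q : nat) := \sum_(p < M.+1)
  (z^* ^+ p + (e p)^* / k^*) * (beta * z ^+ (p + q) + t%:C * wn (p + q)%N).
(* Since [u] times [A] on the adjoint side is [s] times the adjoint of [v], the sum [x q] is
   [s^2 / conj k] times [conj (v q)]. The left factor is what remains of [s u_p conj (v q)]. *)
apply: (@pole_estimate_outer _ _ _ _ (fun p => u p 0 * k^* / s%:C) x).
  have kc0 : k^* != 0 by rewrite conjC_eq0.
  have sC0 : s%:C != 0 by rewrite (fmorph_eq0 (real_complex R)) gt_eqF.
  move=> p q.
  have -> : x q = (s ^+ 2)%:C / k^* * (v q 0)^*.
    have Auq : \sum_p (u p 0)^* * A p q = s%:C * (v q 0)^*.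
      move/matrixP: Au => /(_ q 0); rewrite [RHS]mxE => /(congr1 Num.conj).
      rewrite rmorphM /= conjC_real => <-.
      rewrite mxE rmorph_sum /=; apply: eq_bigr => i _.
      by rewrite !mxE rmorphM /= conjCK mulrC.
    have -> : (s ^+ 2)%:C / k^* * (v q 0)^* = s%:C / k^* * (s%:C * (v q 0)^*).
      by rewrite rmorphXn /=; field.
    rewrite -Auq mulr_sumr; apply: eq_bigr => i _; rewrite -AE mulrA.
    congr (_ * _); have := congr1 Num.conj (su i).
    rewrite !(rmorphM, rmorphD, rmorphXn) /= conjC_real => h1.
    by rewrite [RHS]mulrAC h1; field.
  rewrite svdA !mxE big_ord_recl big_ord0 addr0 !mxE rmorphXn /=.
  by field; rewrite kc0.
have [p up0] : exists p, u p 0 != 0.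
  apply/existsP; apply: contraT; rewrite negb_exists => /forallP y0.
  move: u2; rewrite big1 => [/esym/eqP|p _]; first by rewrite oner_eq0.
  by have := y0 p; rewrite negbK => /eqP ->; rewrite cmod0 expr0n.
exists p; rewrite !mulf_neq0 ?invr_eq0 ?conjC_eq0 //.
by rewrite (fmorph_eq0 (real_complex R)) gt_eqF.
Unshelve. all: by end_near.
Qed.
End PerturbedPole.

(** * Limits in the complex plane through the real-valued modulus *)

Section ComplexLimits.
Context {R : realType}.
Implicit Types (x : R[i]).

Lemma conjC_complexE (a b : R) : (Complex a b)^* = Complex a (- b).
Proof. by []. Qed.

Lemma normRe_le_cmod x : `|complex.Re x| <= cmod x.
Proof.
case: x => a b /=; rewrite -sqrtr_sqr ler_wsqrtr // lerDl sqr_ge0 //.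
Qed.

Lemma normIm_le_cmod x : `|complex.Im x| <= cmod x.
Proof.
case: x => a b /=; rewrite -sqrtr_sqr ler_wsqrtr // lerDr sqr_ge0 //.
Qed.

Section Limits.
Context {T : Type} {F : set_system T} {FF : Filter F}.
Implicit Types (f : T -> R[i]) (l : R[i]).

(** The norm of [R[i]] takes values in [R[i]], and so do the tolerances; a positive element of
    [R[i]] is real, hence real tolerances suffice. *)
Lemma cvgC_cmodP f l : (f : T -> R[i]^o) @ F --> (l : R[i]^o) <->
  forall e : R, 0 < e -> \forall x \near F, cmod (l - f x) < e.
Proof.
split=> [/cvgrPdist_lt fl e e0|fl].
  have := fl e%:C; rewrite ltcR => /(_ e0); apply: filterS => x /=.
  by rewrite normC_cmod ltcR.
apply/cvgrPdist_lt => e e0.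
have eE : e = (complex.Re e)%:C by rewrite RRe_real // gtr0_real.
have := fl (complex.Re e); rewrite eE ltcR in e0 *; move=> /(_ e0).
by apply: filterS => x /=; rewrite normC_cmod eE ltcR.
Qed.

Lemma cvg_complexRe f l : (f : T -> R[i]^o) @ F --> (l : R[i]^o) ->
  complex.Re (f x) @[x --> F] --> complex.Re l.
Proof.
move=> /cvgC_cmodP fl; apply/cvgrPdist_lt => e /fl; apply: filterS => x.
apply: le_lt_trans; have := normRe_le_cmod (l - f x).
by case: (l) (f x) => a b [c d].
Qed.

Lemma cvg_complexIm f l : (f : T -> R[i]^o) @ F --> (l : R[i]^o) ->
  complex.Im (f x) @[x --> F] --> complex.Im l.
Proof.
move=> /cvgC_cmodP fl; apply/cvgrPdist_lt => e /fl; apply: filterS => x.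
apply: le_lt_trans; have := normIm_le_cmod (l - f x).
by case: (l) (f x) => a b [c d].
Qed.

Lemma cvg_conjC f l : (f : T -> R[i]^o) @ F --> (l : R[i]^o) ->
  ((f x)^* : R[i]^o) @[x --> F] --> (l^* : R[i]^o).
Proof.
move=> /cvgC_cmodP fl; apply/cvgC_cmodP => e /fl; apply: filterS => x.
by rewrite -rmorphB cmod_conj.
Qed.

Lemma cvg_real_complex (f : T -> R) (l : R) : f @ F --> l ->
  ((f x)%:C : R[i]^o) @[x --> F] --> (l%:C : R[i]^o).
Proof.
move=> /cvgrPdist_lt fl; apply/cvgC_cmodP => e /fl; apply: filterS => x.
by rewrite -rmorphB cmod_real.
Qed.

End Limits.
End ComplexLimits.

(** * Differentiating a branch of the argument along a curve *)

Section ArgumentDerivative.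
Context {R : realType}.

Lemma expi_conjM (a b : R) : expi a * (expi b)^* = expi (a - b).
Proof.
rewrite /expi conjC_complexE cosB sinB.
apply/eqP; rewrite eq_complex /=; apply/andP; split; apply/eqP; ring.
Qed.

(** Near 0 the phase difference [phi] lies in [(-pi/2, pi/2)] and its tangent is the quotient [g] of
    the imaginary and real parts of [f t * conj z]. Hence [phi = atan g], where [g] vanishes at 0
    with slope [l] and [atan] has slope 1. *)
Lemma is_derive1_arg_comp (arg : R[i] -> R) (z : R[i]) (f : R -> R[i]) (l : R) :
  cmod z = 1 -> arg_branch z arg ->
  (f : R -> R[i]^o) @ (0 : R) --> (z : R[i]^o) ->
  complex.Im (f t * z^*) / t @[t --> (0 : R)^'] --> l ->
  is_derive (0 : R) 1 (arg \o f) l.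
Proof.
move=> z1 arg_z fz Im_l.
(* The limit is along full neighbourhoods, which contain 0, so it forces the value there. *)
have f0 : f 0 = z.
  move/cvgC_cmodP: fz => fz; apply/eqP; rewrite eq_sym -subr_eq0 -cmod_eq0.
  rewrite eq_le cmod_ge0 andbT leNgt; apply/negP => /fz /nbhs_singleton.
  by rewrite ltxx.
have [zE arg_cont] := nbhs_singleton arg_z.
pose phi t := arg (f t) - arg z.
have phi0 : phi t @[t --> (0 : R)] --> 0.
  have argf : arg (f t) @[t --> (0 : R)] --> arg z by exact: (cvg_comp _ _ fz arg_cont).
  have /= := cvgB argf (cvg_cst (arg z)); rewrite subrr; exact.
pose g t := complex.Im (f t * z^*) / complex.Re (f t * z^*).
have zz : z * z^* = 1 by rewrite -normCK normC_cmod z1 expr1n.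
have fz1 : ((f t * z^*) : R[i]^o) @[t --> (0 : R)] --> (1 : R[i]^o).
  by rewrite -zz; apply: (@cvgM _ _ _ _ (f : R -> R[i]^o)) => //; exact: cvg_cst.
have g0 : g 0 = 0 by rewrite /g f0 zz /= mul0r.
have dg : is_derive (0 : R) 1 g l.
  have lim : (h^-1 *: (g (h *: 1 + 0) - g 0)) @[h --> (0 : R)^'] --> l.
    have : (complex.Im (f t * z^*) / t) / complex.Re (f t * z^*) @[t --> (0 : R)^'] --> l / 1.
      apply: cvgM => //; apply: (@cvgV _ _ _ _ (fun t => complex.Re (f t * z^*))).
        exact: oner_neq0.
      by apply: cvg_within_filter; exact: (cvg_complexRe fz1).
    rewrite divr1; apply: cvg_trans; apply: near_eq_cvg; near=> t.
    by rewrite g0 subr0 addr0 [t *: 1]mulr1 /g /= [RHS]mulrC mulrAC.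
  apply: DeriveDef; first by apply/cvg_ex; exists l.
  by rewrite /derive; apply: cvg_lim; [exact: norm_hausdorff|exact: lim].
have phiE : \forall t \near (0 : R), phi t = atan (g t).
  have branch : \forall t \near (0 : R), f t = (cmod (f t))%:C * expi (arg (f t)).
    have near_f : \forall t \near (0 : R), f t = (cmod (f t))%:C * expi (arg (f t)) /\
        {for f t, continuous (arg : R[i]^o -> R)} by exact: (fz _ arg_z).
    by apply: filterS near_f => t [].
  have pi2 : (0 : R) < pi / 2 by rewrite divr_gt0 // pi_gt0.
  have phi_lt := (cvgrPdist_lt _ _).1 phi0 _ pi2.
  have Re_lt := (cvgrPdist_lt _ _).1 (cvg_complexRe fz1) _ ltr01.
  near=> t.
  have ft : f t = (cmod (f t))%:C * expi (arg (f t)).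
    by near: t; exact: branch.
  have pt : `|0 - phi t| < pi / 2 by near: t; exact: phi_lt.
  have rt : `|1 - complex.Re (f t * z^*)| < 1 by near: t; exact: Re_lt.
  have fzE : f t * z^* = (cmod (f t))%:C * expi (phi t).
    by rewrite {1}ft zE z1 mul1r -mulrA expi_conjM.
  rewrite -[LHS]tanK; last first.
    by rewrite in_itv /=; move: pt; rewrite sub0r normrN ltr_norml.
  congr atan; rewrite /g fzE /tan /= !mul0r subr0 addr0 -mulf_div divff ?mul1r //.
  (* The cancelled modulus of [f t] is nonzero: otherwise the real part would be 0, at distance 1
     from its limit 1. *)
  apply: contraTneq rt => c0; rewrite fzE c0 mul0r subr0 normr1 ltxx //.
have dphi : is_derive (0 : R) 1 phi l.
  have datan : is_derive (g 0) 1 (@atan R) 1.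
    by have := is_derive1_atan (g 0); rewrite g0 expr0n addr0 invr1.
  have := is_derive1_comp datan dg.
  rewrite mul1r; apply: near_eq_is_derive.
  by apply: filterS phiE => t ->.
have -> : arg \o f = phi \+ cst (arg z).
  by apply/funext => t; rewrite /= /phi subrK.
by rewrite -[l]addr0; exact: is_deriveD.
Unshelve. all: by end_near.
Qed.
End ArgumentDerivative.

Lemma cvg_sumC {R : realType} {T : Type} {F : set_system T} {FF : Filter F}
    (n : nat) (f : 'I_n -> T -> R[i]^o) (l : 'I_n -> R[i]^o) :
  (forall i, f i @ F --> l i) ->
  (\sum_(i < n) f i x : R[i]^o) @[x --> F] --> (\sum_(i < n) l i : R[i]^o).
Proof. by move=> fl; apply: cvg_big => //; exact: add_continuous. Qed.

Lemma Im_sum (R : realType) (I : Type) (r : seq I) (Q : pred I) (F : I -> R[i]) :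
  complex.Im (\sum_(i <- r | Q i) F i) = \sum_(i <- r | Q i) complex.Im (F i).
Proof.
by apply: (big_ind2 (fun x y => complex.Im x = y)) => // -[a b] c [a' b'] c' <- <-.
Qed.

Lemma Im_mulC_real (R : realType) (x : R[i]) (a : R) :
  complex.Im (x * a%:C) = complex.Im x * a.
Proof. by case: x => b c /=; rewrite mulr0 add0r. Qed.

Lemma complexImB (R : realType) (x y : R[i]) :
  complex.Im (x - y) = complex.Im x - complex.Im y.
Proof. by case: x y => a b [c d]. Qed.

(** * First-order behaviour of the argument of the pole estimate *)

Section PoleArgumentDerivative.
Context {R : realType} {M G : nat}.

(** The term [|B|^2] is real, and [Im (conj m * B) = - Im (conj B * m)]. For consecutive [m] and
    [m'] the first-order part is then a telescoping difference. *)
Let im_cross (B m m' : R[i]) (t : R) :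
  complex.Im ((B + t%:C * m)^* * (B + t%:C * m')) =
  t * (complex.Im (B^* * m') - complex.Im (B^* * m)
       + t * complex.Im (m^* * m')).
Proof.
case: B m m' => a b [c d] [e f]; rewrite !conjC_complexE /=; ring.
Qed.

(** Factoring [x_q = z^q y_q] turns the estimate into [z N / D] with [D] real, so only
    [Im N / (t D)] needs a limit. The limit of [Im N / t] carries one factor [M + 1] and that of [D]
    two, which leaves one in the denominator. *)
Lemma is_derive1_arg_pole_estimate (arg : R[i] -> R) (beta z : R[i])
    (w : 'I_(M + G) -> R[i]) (wn : nat -> R[i]) : (1 < G)%N ->
  (forall k, w k = wn k) -> beta != 0 -> cmod z = 1 -> arg_branch z arg ->
  is_derive (0 : R) 1 (fun t => arg (pole_estimate (observations beta z w t)))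
    (complex.Im (beta^* * \sum_(p < M.+1)
       (z^* ^+ (p + G.-1) * wn (p + G.-1)%N - z^* ^+ p * wn p))
     / (cmod beta ^+ 2 * (M.+1%:R * G.-1%:R))).
Proof.
move=> G1 wE b0 z1 arg_z.
have zz : z^* * z = 1 by rewrite mulrC -normCK normC_cmod z1 expr1n.
have zzX q : z^* ^+ q * z ^+ q = 1 by rewrite -exprMn zz expr1n.
have [C near_pole] := pole_estimate_near (ltnW G1) wE b0 z1.
pose X (eta : 'I_M.+1 -> R[i]) (t : R) q := \sum_(p < M.+1)
  (z^* ^+ p + eta p) * (beta * z ^+ (p + q) + t%:C * wn (p + q)%N).
(* Choice gathers the weights found for each [t] into one function, with the default 0 where there
   are none, so that limits in [t] make sense. *)
have [eta etaP] : exists eta : R -> 'I_M.+1 -> R[i], \forall t \near (0 : R),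
    (forall p, cmod (eta t p) <= C * `|t|) /\
    pole_estimate (observations beta z w t) =
      (\sum_(q < G.-1) (X (eta t) t q)^* * X (eta t) t q.+1) /
      (\sum_(q < G.-1) (X (eta t) t q)^* * X (eta t) t q).
  pose Q (t : R) (e : 'I_M.+1 -> R[i]) := (forall p, cmod (e p) <= C * `|t|) /\
    pole_estimate (observations beta z w t) =
      (\sum_(q < G.-1) (X e t q)^* * X e t q.+1) /
      (\sum_(q < G.-1) (X e t q)^* * X e t q).
  have [eta h] : {eta : R -> 'I_M.+1 -> R[i] &
      forall t, (exists e, Q t e) -> Q t (eta t)}.
    apply: (@choice _ _ (fun t e => (exists e, Q t e) -> Q t e)) => t.
    have [[e Qe]|nQ] := pselect (exists e, Q t e); first by exists e.
    by exists (fun=> 0) => /nQ.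
  by exists eta; apply: filterS near_pole => t /h.
have eta0 p : (eta t p : R[i]^o) @[t --> (0 : R)] --> (0 : R[i]^o).
  apply/cvgC_cmodP => e e0; have e20 : 0 < e / 2 by rewrite divr_gt0.
  near=> t; rewrite sub0r -mulN1r cmodM.
  have -> : cmod (-1 : R[i]) = 1 by rewrite -(rmorphN1 (real_complex R)) cmod_real normrN1.
  rewrite mul1r.
  have [le_eta _] : (forall p, cmod (eta t p) <= C * `|t|) /\
    pole_estimate (observations beta z w t) =
      (\sum_(q < G.-1) (X (eta t) t q)^* * X (eta t) t q.+1) /
      (\sum_(q < G.-1) (X (eta t) t q)^* * X (eta t) t q).
    by near: t.
  have tC : `|t| * `|C| <= e / 2 by near: t; apply: near0_normM_le.
  rewrite (le_lt_trans (le_eta p)) // (@le_lt_trans _ _ (`|t| * `|C|)) //.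
    by rewrite mulrC ler_wpM2l // ler_norm.
  lra.
pose B t : R[i]^o := beta * \sum_(p < M.+1) (z^* ^+ p + eta t p) * z ^+ p.
pose m t q : R[i]^o :=
  \sum_(p < M.+1) (z^* ^+ p + eta t p) * (z^* ^+ q * wn (p + q)%N).
pose y t q : R[i]^o := B t + t%:C * m t q.
have XE t q : X (eta t) t q = z ^+ q * y t q.
  rewrite /X /y /B /m !(mulr_sumr, mulr_suml) -big_split /= mulr_sumr.
  apply: eq_bigr => p _; rewrite exprD.
  rewrite -[wn _ in LHS]mul1r -(zzX q); ring.
pose m0 q : R[i] := \sum_(p < M.+1) z^* ^+ (p + q) * wn (p + q)%N.
have etaD (p : 'I_M.+1) : (z^* ^+ p + eta t p : R[i]^o) @[t --> (0 : R)] --> (z^* ^+ p : R[i]^o).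
  have := cvgD (cvg_cst (z^* ^+ p : R[i]^o)) (eta0 p).
  by rewrite addr0; exact.
have B_cvg : B t @[t --> (0 : R)] --> (beta * M.+1%:R : R[i]^o).
  have -> : beta * M.+1%:R = beta * \sum_(p < M.+1) z^* ^+ p * z ^+ p.
    by under eq_bigr do rewrite zzX; rewrite sumr_const card_ord.
  apply: cvgM; first exact: cvg_cst.
  apply: cvg_sumC => p; apply: cvgM; [exact: etaD|exact: cvg_cst].
have m_cvg q : m t q @[t --> (0 : R)] --> (m0 q : R[i]^o).
  rewrite /m0; under eq_bigr do rewrite exprD -mulrA.
  apply: cvg_sumC => p; apply: cvgM; [exact: etaD|exact: cvg_cst].
have t_cvg : (t%:C : R[i]^o) @[t --> (0 : R)] --> (0 : R[i]^o).
  by apply: (@cvg_real_complex _ _ _ _ id 0); exact: cvg_id.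
have y_cvg q : y t q @[t --> (0 : R)] --> (beta * M.+1%:R : R[i]^o).
  have e : beta * M.+1%:R + 0 * m0 q = beta * M.+1%:R by rewrite mul0r addr0.
  rewrite -e; apply: cvgD; first exact: B_cvg.
  by apply: cvgM; [exact: t_cvg|exact: m_cvg].
pose b := (beta * M.+1%:R)^* * (beta * M.+1%:R).
pose N t : R[i]^o := \sum_(q < G.-1) (y t q)^* * y t q.+1.
pose D t : R[i]^o := \sum_(q < G.-1) (y t q)^* * y t q.
have N_cvg : N t @[t --> (0 : R)] --> (\sum_(q < G.-1) b : R[i]^o).
  apply: cvg_sumC => q; apply: cvgM; last exact: y_cvg.
  exact: (cvg_conjC (y_cvg q)).
have D_cvg : D t @[t --> (0 : R)] --> (\sum_(q < G.-1) b : R[i]^o).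
  apply: cvg_sumC => q; apply: cvgM; last exact: y_cvg.
  exact: (cvg_conjC (y_cvg q)).
pose r : R := cmod beta ^+ 2 * (M.+1%:R ^+ 2 * G.-1%:R).
have rE : \sum_(q < G.-1) b = r%:C.
  rewrite sumr_const card_ord /b rmorphM /= conjC_nat -mulr_natr.
  rewrite /r rmorphM /= cmod_sqr rmorphM rmorphXn /= !rmorph_nat; ring.
have r0 : 0 < r.
  by rewrite !mulr_gt0 ?exprn_gt0 ?cmod_gt0 ?ltr0n // -ltnS prednK // ltnW.
have DR t : D t = (\sum_(q < G.-1) cmod (y t q) ^+ 2)%:C.
  by rewrite rmorph_sum /=; apply: eq_bigr => q _; rewrite cmod_sqr.
have rC0 : r%:C != 0 by rewrite (fmorph_eq0 (real_complex R)) gt_eqF.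
have poleE : \forall t \near (0 : R), pole_estimate (observations beta z w t) = z * N t / D t.
  apply: filterS etaP => t [_ ->]; congr (_ / _).
    rewrite mulr_sumr; apply: eq_bigr => q _; rewrite !XE !rmorphM rmorphXn /= exprS.
    rewrite -[RHS]mul1r -(zzX q); ring.
  apply: eq_bigr => q _; rewrite !XE !rmorphM rmorphXn /=.
  rewrite -[RHS]mul1r -(zzX q); ring.
have pole_cvg :
    (pole_estimate (observations beta z w t) : R[i]^o) @[t --> (0 : R)] -->
    (z : R[i]^o).
  have : z * N t / D t @[t --> (0 : R)] --> (z * r%:C / r%:C : R[i]^o).
    rewrite -rE; apply: (@cvgM _ _ _ _ (fun t => z * N t : R[i]^o)).
      by apply: cvgM; [exact: cvg_cst|exact: N_cvg].
    by apply: (@cvgV _ _ _ _ D); [rewrite rE|exact: D_cvg].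
  rewrite (_ : z * r%:C / r%:C = z); last by rewrite mulfK.
  apply: cvg_trans; apply: near_eq_cvg.
  by apply: filterS poleE => t ->.
(* Summing [im_cross] over [q] leaves only the end terms [m_(G-1)] and [m_0] at first order. *)
have imN t : complex.Im (N t) =
    t * (complex.Im ((B t)^* * (m t G.-1 - m t 0%N))
         + t * complex.Im (\sum_(q < G.-1) (m t q)^* * m t q.+1)).
  rewrite /N Im_sum; under eq_bigr do rewrite im_cross.
  rewrite -mulr_sumr big_split /= -mulr_sumr -Im_sum; congr (_ * (_ + _)).
  rewrite mulrBr complexImB.
  rewrite -(telescope_sumr (fun q => complex.Im ((B t)^* * m t q))) ?leq0n //.
  by rewrite big_mkord.
pose mu t := complex.Im ((B t)^* * (m t G.-1 - m t 0%N))
         + t * complex.Im (\sum_(q < G.-1) (m t q)^* * m t q.+1).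
pose mu0 := complex.Im ((beta * M.+1%:R)^* * (m0 G.-1 - m0 0%N)).
have mu_cvg : mu t @[t --> (0 : R)] --> mu0.
  have e : mu0 + 0 * complex.Im (\sum_(q < G.-1) (m0 q)^* * m0 q.+1) = mu0.
    by rewrite mul0r addr0.
  rewrite -e; apply: cvgD.
    apply: (@cvg_complexIm _ _ _ _ (fun t => (B t)^* * (m t G.-1 - m t 0%N))).
    apply: cvgM; first exact: (cvg_conjC B_cvg).
    by apply: cvgB; exact: m_cvg.
  apply: cvgM; first exact: cvg_id.
  apply: (@cvg_complexIm _ _ _ _ (fun t => \sum_(q < G.-1) (m t q)^* * m t q.+1)).
  apply: cvg_sumC => q; apply: cvgM; last exact: m_cvg.
  exact: (cvg_conjC (m_cvg q)).
pose dn t : R := \sum_(q < G.-1) cmod (y t q) ^+ 2.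
have dn_cvg : dn t @[t --> (0 : R)] --> r.
  have dnE : dn = (fun t => complex.Re (D t)) by apply/funext => t; rewrite DR.
  have rR : r = complex.Re (\sum_(q < G.-1) b) by rewrite rE.
  by rewrite dnE rR; exact: (cvg_complexRe D_cvg).
set L := (X in is_derive _ _ _ X).
have LE : mu0 / r = L.
  rewrite /mu0 /L /m0 -sumrB; under [in LHS]eq_bigr do rewrite addn0.
  set S := \sum_(p < M.+1) _.
  have -> : (beta * M.+1%:R)^* * S = beta^* * S * (M.+1%:R)%:C.
    by rewrite rmorphM /= conjC_nat rmorph_nat; ring.
  have g0 : G.-1%:R != 0 :> R by rewrite pnatr_eq0 -lt0n -ltnS prednK // ltnW.
  rewrite Im_mulC_real /r; field.
  by rewrite g0 cmod_eq0 b0 nat1r pnatr_eq0.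
apply: (is_derive1_arg_comp z1 arg_z pole_cvg).
have : mu t / dn t @[t --> (0 : R)^'] --> L.
  rewrite -LE; apply: cvgM; first exact: cvg_within_filter.
  apply: (@cvgV _ _ _ _ dn); first by rewrite gt_eqF.
  exact: cvg_within_filter.
apply: cvg_trans; apply: near_eq_cvg; near=> t.
have -> : pole_estimate (observations beta z w t) = z * N t / D t.
  by near: t; apply: cvg_within; exact: poleE.
have t0 : t != 0 by near: t; exact: nbhs_dnbhs_neq.
have -> : z * N t / D t * z^* = N t * ((dn t)^-1)%:C.
  rewrite DR -/(dn t) fmorphV /= -[RHS]mul1r -zz; ring.
by rewrite Im_mulC_real imN -/(mu t); move: (dn t)^-1 => d; field.
Unshelve. all: by end_near.
Qed.
End PoleArgumentDerivative.

(** * Second moments of the noise *)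

Section SecondMoments.
Local Open Scope ereal_scope.
Context {R : realType} {d : measure_display} {T : measurableType d}.
Variable P : probability T R.
Implicit Types (X Y : T -> R).

Lemma Lfun2_measurable X : X \in Lfun P 2%:E -> measurable_fun setT X.
Proof. by rewrite inE => /andP[]; rewrite inE. Qed.

Lemma Lfun12 X : X \in Lfun P 2%:E -> X \in Lfun P 1.
Proof. by apply: Lfun_subset12; exact: fin_num_measure. Qed.

Lemma Lfun2_second_moment X : measurable_fun setT X ->
  'E_P[(X ^+ 2)%R] < +oo -> X \in Lfun P 2%:E.
Proof.
move=> mX; rewrite unlock => X2.
rewrite inE; apply/andP; split; rewrite inE //= /finite_norm unlock /Lnorm.
rewrite poweR_lty //; under eq_integral => x _.
  rewrite /= powR_mulrn // real_normK ?num_real //; over.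
exact: X2.
Qed.

(** Both sides are integrals of the square function against the distributions, which agree on
    measurable sets. *)
Lemma same_law_second_moment X Y :
  measurable_fun setT X -> measurable_fun setT Y ->
  (forall B : set R, measurable B -> P (X @^-1` B) = P (Y @^-1` B)) ->
  'E_P[(X ^+ 2)%R] = 'E_P[(Y ^+ 2)%R].
Proof.
move=> mX mY XY.
pose X' : {mfun T >-> R} := HB.pack X (isMeasurableFun.Build _ _ _ _ X mX).
pose Y' : {mfun T >-> R} := HB.pack Y (isMeasurableFun.Build _ _ _ _ Y mY).
pose sq (x : R) : \bar R := (x ^+ 2)%:E.
have msq : measurable_fun setT sq.
  by apply/measurable_EFinP; exact: measurable_funX.
have sq0 x : 0 <= sq x by rewrite lee_fin sqr_ge0.
rewrite unlock -[LHS](@ge0_integral_distribution _ _ _ _ _ P X' _ msq sq0).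
rewrite -[RHS](@ge0_integral_distribution _ _ _ _ _ P Y' _ msq sq0).
by apply: eq_measure_integral => A mA _; exact: XY.
Qed.

(** By uniqueness of the product measure, the law of the pair is the product of the laws; Fubini
    then separates the integral of [x * y]. *)
Lemma expectationM_indep X Y :
  X \in Lfun P 2%:E -> Y \in Lfun P 2%:E ->
  (forall A B : set R, measurable A -> measurable B ->
    P (X @^-1` A `&` Y @^-1` B) = P (X @^-1` A) * P (Y @^-1` B)) ->
  'E_P[(X * Y)%R] = 'E_P[X] * 'E_P[Y].
Proof.
move=> X2 Y2 XY.
have mX := Lfun2_measurable X2; have mY := Lfun2_measurable Y2.
have mXY : measurable_fun setT (fun t => (X t, Y t)) by exact: measurable_fun_pair.
pose X' : {mfun T >-> R} := HB.pack X (isMeasurableFun.Build _ _ _ _ X mX).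
pose Y' : {mfun T >-> R} := HB.pack Y (isMeasurableFun.Build _ _ _ _ Y mY).
pose Z' : {mfun T >-> (R * R)%type} := HB.pack (fun t => (X t, Y t))
  (isMeasurableFun.Build _ _ _ _ (fun t => (X t, Y t)) mXY).
pose f (p : R * R) := (p.1 * p.2)%:E.
have mf : measurable_fun setT f.
  by apply/measurable_EFinP; apply: measurable_funM; [exact: measurable_fst|exact: measurable_snd].
have lawE : forall A, measurable A ->
    (distribution P X' \x distribution P Y') A = distribution P Z' A.
  by apply: product_measure_unique => A B mA mB; rewrite /= /pushforward -XY.
have fZ : P.-integrable setT (f \o Z').
  by apply/Lfun1_integrable; exact: Lfun2_mul_Lfun1.
have intX : P.-integrable setT (EFin \o X) by apply/Lfun1_integrable/Lfun12.
have intY : P.-integrable setT (EFin \o Y) by apply/Lfun1_integrable/Lfun12.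
have fprod : (distribution P X' \x distribution P Y').-integrable setT f.
  apply/integrableP; split => //.
  rewrite (eq_measure_integral (distribution P Z')) => [|A mA _]; last exact: lawE.
  have /integrableP[_] := integrable_pushforward mXY mf fZ measurableT.
  by [].
rewrite unlock -[LHS](@integral_distribution _ _ _ _ _ P Z' _ mf fZ).
rewrite (eq_measure_integral (distribution P X' \x distribution P Y')).
  2: by move=> A mA _; exact/esym/lawE.
rewrite -integral12_prod_meas1 // /fubini_F.
pose idE (x : R) : \bar R := x%:E.
have mid : measurable_fun setT idE by exact/measurable_EFinP.
rewrite -[in RHS](@integral_distribution _ _ _ _ _ P X' _ mid intX).
rewrite -[in RHS](@integral_distribution _ _ _ _ _ P Y' _ mid intY).
have idY : (distribution P Y').-integrable setT idE by exact: integrable_pushforward.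
have idX : (distribution P X').-integrable setT idE by exact: integrable_pushforward.
have intYE : \int[distribution P Y']_y idE y = (fine (\int[distribution P Y']_y idE y))%:E.
  by rewrite fineK // integrable_fin_num.
transitivity (\int[distribution P X']_x (idE x * (fine (\int[distribution P Y']_y idE y))%:E)).
  apply: eq_integral => x _; rewrite -intYE /f /=.
  by under eq_integral do rewrite EFinM; rewrite integralZl.
by rewrite integralZr // -intYE.
Qed.

Lemma covariance_indep X Y :
  X \in Lfun P 2%:E -> Y \in Lfun P 2%:E ->
  (forall A B : set R, measurable A -> measurable B ->
    P (X @^-1` A `&` Y @^-1` B) = P (X @^-1` A) * P (Y @^-1` B)) ->
  covariance P X Y = 0.
Proof.
move=> X2 Y2 XY; have X1 := Lfun12 X2; have Y1 := Lfun12 Y2.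
rewrite covarianceE //; last exact: Lfun2_mul_Lfun1.
rewrite (expectationM_indep X2 Y2 XY) subee // fin_numM //; exact: expectation_fin_num.
Qed.

Lemma variance_sum_uncorrelated (I : eqType) (s : seq I) (X : I -> T -> R) :
  uniq s -> (forall i, X i \in Lfun P 2%:E) ->
  (forall i j, i != j -> covariance P (X i) (X j) = 0) ->
  (\sum_(i <- s) X i)%R \in Lfun P 2%:E /\
  'V_P[(\sum_(i <- s) X i)%R] = \sum_(i <- s) 'V_P[X i].
Proof.
move=> us X2 cov0.
have S2 (r : seq I) : (\sum_(i <- r) X i)%R \in Lfun P 2%:E.
  by apply: rpred_sum; rewrite ?lee1n // => i _; exact: X2.
split; first exact: S2.
elim: s us => [|i s IH] /=; first by rewrite !big_nil variance_cst.
move=> /andP[is_ us]; rewrite !big_cons varianceD // IH //.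
(* A second induction, by additivity of the covariance in its right argument. *)
suff -> : covariance P (X i) (\sum_(j <- s) X j)%R = 0 by rewrite mule0 adde0.
elim: s is_ {us IH} => [|j s IH]; first by rewrite big_nil covariance_cst_r.
rewrite inE negb_or => /andP[ij is_].
by rewrite big_cons covarianceDr // IH // cov0 // add0e.
Qed.

End SecondMoments.

(** * Variance of a real linear form in a circularly symmetric variable *)

Section CircularMoments.
Local Open Scope ereal_scope.
Context {R : realType} {d : measure_display} {T : measurableType d}.
Variable P : probability T R.

Lemma complexImM (a x : R[i]) :
  complex.Im (a * x)%R = (complex.Im x * complex.Re a + complex.Re x * complex.Im a)%R.
Proof. by case: a x => a b [c e] /=; ring. Qed.

(** Transfers circular symmetry and independence, which are stated for planar Borel sets, to the
    real variables [Im (a * X)]. *)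
Lemma borelC_ImM (a : R[i]) (A : set R) : measurable A ->
  borelC [set x | A (complex.Im (a * x)%R)].
Proof.
move=> mA; rewrite /borelC.
have mf : measurable_fun setT (fun p : R * R => (p.2 * complex.Re a + p.1 * complex.Im a)%R).
  by apply: measurable_funD; apply: measurable_funM.
have := mf measurableT A mA; rewrite setTI.
by congr measurable; apply/seteqP; split => -[x y] /=; rewrite complexImM.
Qed.

Variables (X : T -> R[i]) (s : R).
Hypotheses (mX : complex_rv X) (circX : circularly_symmetric P X).
Hypotheses (meanX : zero_mean P X) (powX : mean_power P X = s%:E).

Let ReX t := complex.Re (X t).
Let ImX t := complex.Im (X t).

Let cmod2 t : (cmod (X t) ^+ 2)%R = (ReX t ^+ 2 + ImX t ^+ 2)%R.
Proof.
by rewrite /ReX /ImX; case: (X t) => a b; rewrite /cmod /= sqr_sqrtr // addr_ge0 // sqr_ge0.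
Qed.

Let mcmod2 : measurable_fun setT (fun t => (cmod (X t) ^+ 2)%R).
Proof.
under eq_fun do rewrite cmod2.
by apply: measurable_funD; apply: measurable_funX; [exact: mX.1|exact: mX.2].
Qed.

Let ReX2 : ReX \in Lfun P 2%:E.
Proof.
apply: Lfun2_second_moment; first exact: mX.1.
apply: (@le_lt_trans _ _ (mean_power P X)); last by rewrite powX ltry.
apply: expectation_le => //.
- exact: (measurable_funM mX.1 mX.1).
- by move=> t; exact: (sqr_ge0 (ReX t)).
- by move=> x; rewrite sqr_ge0.
- apply/aeW => t; rewrite cmod2 -[leLHS]/(ReX t ^+ 2)%R.
  by rewrite lerDl sqr_ge0.
Qed.

Let ImX2 : ImX \in Lfun P 2%:E.
Proof.
apply: Lfun2_second_moment; first exact: mX.2.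
apply: (@le_lt_trans _ _ (mean_power P X)); last by rewrite powX ltry.
apply: expectation_le => //.
- exact: (measurable_funM mX.2 mX.2).
- by move=> t; exact: (sqr_ge0 (ImX t)).
- by move=> x; rewrite sqr_ge0.
- apply/aeW => t; rewrite cmod2 -[leLHS]/(ImX t ^+ 2)%R.
  by rewrite lerDr sqr_ge0.
Qed.

Let ImME a : (fun t => complex.Im (a * X t)%R) = (complex.Re a \o* ImX \+ complex.Im a \o* ReX)%R.
Proof. by apply/funext => t; rewrite complexImM. Qed.

Lemma Lfun2_ImM a : (fun t => complex.Im (a * X t)%R) \in Lfun P 2%:E.
Proof.
rewrite ImME.
have p1 : 1 <= 2%:E :> \bar R by rewrite lee1n.
have le12 : (1 <= 2 :> R)%R by rewrite ler1n.
have hI : (complex.Re a \o* ImX)%R \in Lfun P 2%:E by exact: Lfun_scale.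
have hR : (complex.Im a \o* ReX)%R \in Lfun P 2%:E by exact: Lfun_scale.
exact: ((Lfun_addr_closed P p1).2 _ _ hI hR).
Qed.

Lemma expectation_ImM a : 'E_P[fun t => complex.Im (a * X t)%R] = 0.
Proof.
rewrite ImME expectationD ?Lfun_scale ?Lfun12 ?lexx //.
rewrite !expectationZl ?Lfun12 //.
by case: meanX => -> ->; rewrite !mule0 adde0.
Qed.

Let varE Y : Y \in Lfun P 2%:E -> 'E_P[Y] = 0 -> 'V_P[Y] = 'E_P[(Y ^+ 2)%R].
Proof. by move=> Y2 EY; rewrite varianceE // EY expe2 mule0 sube0. Qed.

(** The variance is a quadratic form in the real and imaginary parts of [a]. Circular symmetry makes
    it constant on the unit circle, hence a multiple of [|a|^2], and the mean power fixes the factor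
    as [s / 2]. *)
Lemma variance_ImM a :
  'V_P[fun t => complex.Im (a * X t)%R] = (cmod a ^+ 2 * (s / 2))%R%:E.
Proof.
have I1 := Lfun12 ImX2; have R1 := Lfun12 ReX2.
have IR1 : (ImX * ReX)%R \in Lfun P 1 := Lfun2_mul_Lfun1 ImX2 ReX2.
have cov_fin := covariance_fin_num I1 R1 IR1.
have le12 : (1 <= 2 :> R)%R by rewrite ler1n.
pose vI := fine 'V_P[ImX]; pose vR := fine 'V_P[ReX].
pose co := fine (covariance P ImX ReX).
have vIE : 'V_P[ImX] = vI%:E by rewrite fineK // variance_fin_num.
have vRE : 'V_P[ReX] = vR%:E by rewrite fineK // variance_fin_num.
have coE : covariance P ImX ReX = co%:E by rewrite fineK.
have quad b : 'V_P[fun t => complex.Im (b * X t)%R] =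
    (complex.Re b ^+ 2 * vI + complex.Im b ^+ 2 * vR
     + 2 * (complex.Re b * complex.Im b * co))%R%:E.
  have bI2 : (complex.Re b \o* ImX)%R \in Lfun P 2%:E by exact: Lfun_scale.
  have bR2 : (complex.Im b \o* ReX)%R \in Lfun P 2%:E by exact: Lfun_scale.
  have IbR1 := Lfun2_mul_Lfun1 ImX2 bR2.
  rewrite ImME varianceD // !varianceZ // vIE vRE.
  rewrite (covarianceZl _ I1 (Lfun12 bR2) IbR1) (covarianceZr _ I1 R1 IR1) coE.
  by rewrite -!EFinM -!EFinD mulrA.
(* Rotation preserves the law, and both variables are centred, so equal second moments suffice. *)
have rot theta : 'V_P[fun t => complex.Im (expi theta * X t)%R] = vI%:E.
  rewrite varE ?Lfun2_ImM ?expectation_ImM // -vIE varE //; last exact: meanX.2.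
  apply: same_law_second_moment.
  - exact/Lfun2_measurable/Lfun2_ImM.
  - exact: mX.2.
  - move=> B mB; have := circX theta (borelC_ImM (1%R : R[i]) mB).
    have preE (Y : T -> R[i]) : Y @^-1` [set x | B (complex.Im (1%R * x)%R)] =
        (fun t => complex.Im (Y t)) @^-1` B.
      by apply/seteqP; split=> t; rewrite /= mul1r.
    by rewrite !preE.
(* Rotating by [pi / 2] exchanges the two variances, and rotating by [pi / 4]
   then isolates the covariance. *)
have vRI : vR = vI.
  have := rot (pi / 2)%R; rewrite quad /expi /= cos_pihalf sin_pihalf => -[] h.
  by rewrite -h; ring.
have co0 : co = 0%R.
  have := rot (pi / 4)%R; rewrite quad /expi /= vRI => -[].
  have p0 := pi_gt0 R.
  have c0 : (0 < cos (pi / 4 : R))%R by apply: cos_gt0_pihalf; lra.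
  have s0 : (0 < sin (pi / 4 : R))%R by apply: sin_gt0_pihalf; lra.
  rewrite -mulrDl cos2Dsin2 mul1r => h.
  have : (cos (pi / 4) * sin (pi / 4) * co = 0)%R by lra.
  by move/eqP; rewrite mulf_eq0 gt_eqF ?mulr_gt0 //= => /eqP.
have vs : (vI + vR = s)%R.
  apply: EFin_inj; rewrite EFinD -vIE -vRE !varE //; [|exact: meanX.1|exact: meanX.2].
  rewrite -powX /mean_power -expectationD ?Lfun1_sqr //.
  - by congr expectation; apply/funext => t; rewrite cmod2 addrC.
  - by rewrite expr2 Lfun2_mul_Lfun1.
  - by rewrite expr2 Lfun2_mul_Lfun1.
rewrite quad; congr EFin; rewrite co0 (_ : vI = s / 2)%R; last lra.
rewrite (_ : vR = s / 2)%R; last lra.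
by case: (a) => x y; rewrite /cmod /= sqr_sqrtr ?addr_ge0 ?sqr_ge0 //; ring.
Qed.

End CircularMoments.

Section LinearForm.
Local Open Scope ereal_scope.
Context {R : realType} {d : measure_display} {T : measurableType d} {n : nat}.
Variable P : probability T R.

(** Independence makes the terms pairwise uncorrelated, so their variances add. *)
Lemma variance_linear_form (w : 'I_n -> T -> R[i]) (s : R) (a : 'I_n -> R[i]) :
  (forall k, complex_rv (w k)) -> mutually_independent P w ->
  (forall k, circularly_symmetric P (w k)) -> (forall k, zero_mean P (w k)) ->
  (forall k, mean_power P (w k) = s%:E) ->
  let L := (\sum_k fun t => complex.Im (a k * w k t)%R)%R in
  L \in Lfun P 2%:E /\ 'V_P[L] = ((\sum_k cmod (a k) ^+ 2) * (s / 2))%R%:E.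
Proof.
move=> mw iw cw zw pw L.
pose X k t := complex.Im (a k * w k t)%R.
have X2 k : X k \in Lfun P 2%:E by apply: (@Lfun2_ImM _ _ _ _ _ s).
have X0 k l : k != l -> covariance P (X k) (X l) = 0.
  move=> kl; apply: covariance_indep => // A B mA mB.
  (* Mutual independence is applied to the pair [{k, l}], with the event of [A] at [k] and that of
     [B] at every other index. *)
  pose S i : set R[i] := if i == k then [set x | A (complex.Im (a k * x)%R)]
    else [set x | B (complex.Im (a l * x)%R)].
  have mS i : borelC (S i) by rewrite /S; case: ifP => _; exact: borelC_ImM.
  have := iw [set k; l]%SET S mS.
  rewrite big_setU1 ?inE //= big_set1 /S eqxx eq_sym (negbTE kl) => <-.
  congr (P _); apply/seteqP; split => t /=.
    move=> [At Bt] i /=; rewrite !inE => /orP[] /eqP ->.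
      by rewrite eqxx.
    by rewrite eq_sym (negbTE kl).
  move=> h; split.
    by have := h k; rewrite /= !inE eqxx /=; exact.
  by have := h l; rewrite /= !inE eqxx orbT eq_sym (negbTE kl); exact.
have [L2 VL] := variance_sum_uncorrelated (index_enum_uniq _) X2 X0.
split; first exact: L2.
rewrite [LHS]VL mulr_suml -sumEFin; apply: eq_bigr => k _.
exact: variance_ImM.
Qed.

End LinearForm.

(** * The first-order variance *)

Lemma sum_last_ord (V : nmodType) (a b n : nat) (F : nat -> V) : n = (a + b)%N ->
  \sum_(p < a) F (p + b)%N = \sum_(k < n | (b <= k)%N) F k.
Proof.
move=> ->; rewrite -(big_geq_mkord _ _ xpredT) -{2}[b]add0n big_addn addnK.
by rewrite big_mkord.
Qed.

(** The square is the indicator of the symmetric difference of [[0, a)] and [[b, a + b)]. Both have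
    [a] elements and they share [a - b], truncated at 0, which leaves
    [2 (a - (a - b)) = 2 min(a, b)]. *)
Lemma sum_sqr_overlap (R : comNzRingType) (a b n : nat) : n = (a + b)%N ->
  \sum_(k < n) ((b <= k)%N%:R - (k < a)%N%:R) ^+ 2 = (minn a b)%:R *+ 2 :> R.
Proof.
move=> nE.
have sumb (Q : pred nat) : \sum_(k < n) (Q k)%:R = (\sum_(k < n | Q k) 1)%:R :> R.
  rewrite natr_sum [RHS]big_mkcond /=; apply: eq_bigr => k _.
  by case: (Q k).
have s1 : \sum_(k < n) (b <= k)%N%:R = a%:R :> R.
  rewrite (sumb (fun k => b <= k)%N) -(@sum_last_ord _ a b n (fun=> 1%N) nE).
  by rewrite sum1_card card_ord.
have s2 : \sum_(k < n) (k < a)%N%:R = a%:R :> R.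
  rewrite (sumb (fun k => k < a)%N) -(big_ord_widen n (fun=> 1%N)).
    by rewrite sum1_card card_ord.
  by rewrite nE leq_addr.
have s3 : \sum_(k < n) ((b <= k) && (k < a))%N%:R = (a - b)%:R :> R.
  rewrite (sumb (fun k => (b <= k) && (k < a))%N).
  rewrite -(big_ord_widen_cond n (fun k => b <= k)%N (fun=> 1%N)); last by rewrite nE leq_addr.
  have -> : (\sum_(k < a | b <= k) 1 = \sum_(b <= k < a) 1)%N by rewrite big_geq_mkord.
  by rewrite sum_nat_const_nat muln1.
rewrite (eq_bigr (fun k : 'I_n => (b <= k)%N%:R + (k < a)%N%:R
    - ((b <= k) && (k < a))%N%:R *+ 2)) => [|k _]; last first.
  by case: (b <= k)%N; case: (k < a)%N => /=; ring.
rewrite sumrB big_split /= sumrMnl s1 s2 s3 -mulr2n -mulrnBl -natrB ?leq_subr //.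
by congr (_%:R *+ 2); rewrite minnE.
Qed.

Lemma cmod_expi (R : realType) (t : R) : cmod (expi t) = 1.
Proof. by rewrite /cmod /= cos2Dsin2 sqrtr1. Qed.

(** Collecting the coefficient of each sample: [w k] enters with a plus sign if [k >= G - 1] and
    with a minus sign if [k <= M], and cancels where both hold. The error becomes a linear form in
    the separate samples. *)
Lemma is_derive1_noisy_distance (R : realType) (M G : nat) (c df : R)
    (arg : R[i] -> R) (beta z : R[i]) (w : 'I_(M + G) -> R[i]) :
  (1 < G)%N -> beta != 0 -> cmod z = 1 -> arg_branch z arg ->
  is_derive (0 : R) 1 (noisy_distance c df arg beta z w)
    ((\sum_(k < M + G) complex.Im (beta^* * z^* ^+ k *
        ((G.-1 <= k)%N%:R - (k < M.+1)%N%:R) * w k))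
     * (- (c / (2 * pi * df)) / (cmod beta ^+ 2 * (M.+1%:R * G.-1%:R)))).
Proof.
move=> G1 b0 z1 arg_z.
(* The noise is extended by zero, so that shifted indices are plain natural numbers. *)
pose wn (k : nat) : R[i] := oapp w 0 (insub k).
have wE k : w k = wn k by rewrite /wn valK.
have d := is_derive1_arg_pole_estimate G1 wE b0 z1 arg_z.
have nE : (M + G = M.+1 + G.-1)%N by rewrite addSnnS prednK // ltnW.
pose F (k : nat) := z^* ^+ k * wn k.
have sumE : \sum_(p < M.+1) (z^* ^+ (p + G.-1) * wn (p + G.-1)%N - z^* ^+ p * wn p) =
    \sum_(k < M + G) ((G.-1 <= k)%N%:R - (k < M.+1)%N%:R) * F k.
  rewrite sumrB (sum_last_ord F nE).
  rewrite (big_ord_widen (M + G) F); last by rewrite nE leq_addr.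
  rewrite big_mkcond [X in _ - X]big_mkcond -sumrB /=; apply: eq_bigr => k _.
  by case: (_ <= _)%N; case: (_ < _)%N => /=; ring.
have ImE : complex.Im (beta^* * \sum_(p < M.+1)
      (z^* ^+ (p + G.-1) * wn (p + G.-1)%N - z^* ^+ p * wn p)) =
    \sum_(k < M + G) complex.Im (beta^* * z^* ^+ k *
      ((G.-1 <= k)%N%:R - (k < M.+1)%N%:R) * w k).
  rewrite sumE mulr_sumr Im_sum; apply: eq_bigr => k _.
  by rewrite wE /F; congr complex.Im; ring.
rewrite ImE in d.
have -> : noisy_distance c df arg beta z w =
    (- (c / (2 * pi * df))) \*: (fun t => arg (pole_estimate (observations beta z w t))).
  apply/funext => t; rewrite /noisy_distance /distance_estimate /delay_estimate /=.
  by rewrite /GRing.scale /=; ring.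
rewrite [X in is_derive _ _ _ X](_ : _ = - (c / (2 * pi * df)) *:
  ((\sum_(k < M + G) complex.Im (beta^* * z^* ^+ k *
      ((G.-1 <= k)%N%:R - (k < M.+1)%N%:R) * w k)) / (cmod beta ^+ 2 * (M.+1%:R * G.-1%:R)))).
  exact: is_deriveZ.
by rewrite /GRing.scale /=; ring.
Qed.

(** Derivability is part of the conclusion so that [derive1] denotes a true derivative and not the
    default value of a missing limit; measurability makes the error a random variable. *)
Theorem theorem2 (R : realType) (d : measure_display) (T : measurableType d)
    (P : probability T R) (M G : nat) (c df sigma2 tau : R) (beta z : R[i])
    (arg : R[i] -> R) (w : 'I_(M + G) -> T -> R[i])
    (hM : (1 <= M)%N) (hG : (2 <= G)%N)
    (hc : 0 < c) (hdf : 0 < df) (hsigma2 : 0 < sigma2) (hbeta : beta != 0)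
    (hz : z = expi (- (2 * pi * df * tau)))
    (harg : arg_branch z arg)
    (hw_rv : forall k, complex_rv (w k))
    (hw_indep : mutually_independent P w)
    (hw_id : identically_distributed P w)
    (hw_gauss : forall k, complex_gaussian P (w k))
    (hw_circ : forall k, circularly_symmetric P (w k))
    (hw_mean : forall k, zero_mean P (w k))
    (hw_power : forall k, mean_power P (w k) = sigma2%:E) :
  [/\ forall omega : T,
        derivable (noisy_distance c df arg beta z (fun k => w k omega)) 0 1,
      measurable_fun setT (first_order_error c df arg beta z w) &
      'V_P[first_order_error c df arg beta z w]%E =
        ((c / (2 * pi * df)) ^+ 2
         * ((minn M.+1 G.-1)%:R / ((M.+1)%:R ^+ 2 * (G.-1)%:R ^+ 2))
         * (sigma2 / cmod beta ^+ 2))%:E].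
Proof.
have z1 : cmod z = 1 by rewrite hz cmod_expi.
have der omega := is_derive1_noisy_distance c df (fun k => w k omega) hG hbeta z1 harg.
pose a (k : 'I_(M + G)) : R[i] :=
  beta^* * z^* ^+ k * ((G.-1 <= k)%N%:R - (k < M.+1)%N%:R).
pose K : R := - (c / (2 * pi * df)) / (cmod beta ^+ 2 * (M.+1%:R * G.-1%:R)).
have [L2 VL] := variance_linear_form a hw_rv hw_indep hw_circ hw_mean hw_power.
set L := (\sum_k _) in L2 VL.
have le12 : 1 <= 2 :> R by rewrite ler1n.
have errE : first_order_error c df arg beta z w = K \o* L.
  apply/funext => omega; rewrite /first_order_error derive1E.
  have [_ ->] := der omega.
  by rewrite /= /L fct_sumE.
split=> [omega||].
- by have [] := der omega.
- have KL2 : K \o* L \in Lfun P 2%:E by exact: Lfun_scale.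
  by rewrite errE; exact: (Lfun2_measurable KL2).
- rewrite errE varianceZ // VL -EFinM; congr (_%:E).
  (* As [|z| = 1], only the overlap of the two index windows matters; the factor 2 cancels the half
     in the variance of each term. *)
  have -> : \sum_k cmod (a k) ^+ 2 = cmod beta ^+ 2 * ((minn M.+1 G.-1)%:R *+ 2).
    have nE : (M + G = M.+1 + G.-1)%N by rewrite addSnnS prednK // ltnW.
    rewrite -(sum_sqr_overlap R nE) mulr_sumr; apply: eq_bigr => k _.
    rewrite /a !cmodM cmodX !cmod_conj z1 expr1n mulr1 exprMn; congr (_ * _).
    have realE (x y : nat) : x%:R - y%:R = (x%:R - y%:R)%:C :> R[i].
      by rewrite rmorphB /= !rmorph_nat.
    by rewrite realE cmod_real real_normK ?num_real.
  have g0 : G.-1%:R != 0 :> R by rewrite pnatr_eq0 -lt0n -ltnS prednK // ltnW.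
  have p0 : pi != 0 :> R by rewrite gt_eqF // pi_gt0.
  rewrite /K; move: (pi : R) p0 => p p0; field.
  by rewrite cmod_eq0 hbeta g0 nat1r pnatr_eq0 (gt_eqF hdf) p0.
Qed.
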